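(* Let $\mathbb{K}$ be a field and let $\mathcal{C}$ be an $[n,k,d]$-linear code over $\mathbb{K}$. Let $\Sigma_{\mathcal{C}}=(\ell_1,\ldots,\ell_n)$ be the collection of $n$ linear forms in $R=\mathbb{K}[x_1,\ldots,x_k]$ dual to the columns of some generating $k\times n$ matrix of $\mathcal{C}$, and let $\mathfrak{m}=\langle x_1,\ldots,x_k\rangle$. Then the minimum distance of $\mathcal{C}$ satisfies $$d=\alpha\big(\mathfrak{m}\,\mathrm{Fitt}(\mathcal{C})\big)-1.$$
   Context: An $[n,k,d]$-linear code $\mathcal{C}$ over a field $\mathbb{K}$ is the image of an injective linear map $\mathbb{K}^k\to\mathbb{K}^n$, $\mathbf{x}\mapsto \mathbf{x}G$, where $G=(a_{ij})$ is a $k\times n$ matrix over $\mathbb{K}$ of rank $k\ge 1$ (a generating matrix); $n$ is the length, $k$ the dimension, and $d$ the minimum distance, i.e. the smallest number of nonzero entries in a nonzero element of $\mathcal{C}$. The linear form dual to the $j$-th column of $G$ is $\ell_j=\sum_{i=1}^k a_{ij}x_i$; repetitions among the $\ell_j$ are allowed. Fitting module. Let $M$ be an $R$-module with free presentation $R^m\xrightarrow{\phi}R^n\to M\to 0$. Let $I_j(\phi)$ be the ideal generated by the $j\times j$ minors of $\phi$, with $I_j(\phi)=R$ for $j\le 0$ and $I_j(\phi)=0$ for $j>\min\{m,n\}$. Put $\mathrm{Fitt}_j(M)=I_{n-j}(\phi)$ and $\mathrm{Fitt}(M)=\bigoplus_{j=0}^n \mathrm{Fitt}_{n-j}(M)/\mathrm{Fitt}_{n-j-1}(M)$.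 The Fitting module of the code is $\mathrm{Fitt}(\mathcal{C}):=\mathrm{Fitt}(M)$ for $M=\mathrm{coker}(\phi)=\bigoplus_{i=1}^n R/\langle \ell_i\rangle$ with $\phi=\mathrm{diag}(\ell_1,\ldots,\ell_n)$. Explicitly, $\mathrm{Fitt}(\mathcal{C})=\bigoplus_{j=0}^{n} I(\mathcal{C},j)/I(\mathcal{C},j+1)$, where $I(\mathcal{C},0)=R$, $I(\mathcal{C},n+1)=0$, and for $1\le j\le n$, $I(\mathcal{C},j)=\langle \ell_{i_1}\cdots\ell_{i_j} : 1\le i_1<\cdots<i_j\le n\rangle\subset R$. Grading. $R$ has the standard grading; each summand $I(\mathcal{C},j)/I(\mathcal{C},j+1)$ is graded with the grading induced from $R$, and a direct sum $\bigoplus M_i$ of graded modules is graded by $(\bigoplus M_i)_t=\bigoplus (M_i)_t$. $\mathfrak{m}\,\mathrm{Fitt}(\mathcal{C})$ is a graded submodule of $\mathrm{Fitt}(\mathcal{C})$. For a finitely generated graded module $N=\bigoplus_{i\ge 0}N_i$, the $\alpha$-invariant $\alpha(N)$ is the smallest $i$ with $N_i\neq 0$. *)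

(* Defs.v *)
From HB Require Import structures.
From mathcomp Require Import all_boot all_order all_algebra.
From mathcomp Require Import generic_quotient ring_quotient boolp mpoly.

Set Implicit Arguments.
Unset Strict Implicit.
Unset Printing Implicit Defensive.

Import GRing.Theory.
Local Open Scope ring_scope.
Local Open Scope quotient_scope.

Section GeneratedSubmodule.
Variables (R : nzRingType) (V : lmodType R).

Definition gen_submod (S : V -> Prop) : {pred V} := fun v =>
  `[< exists m (a : 'I_m -> R) (s : 'I_m -> V),
        (forall i, S (s i)) /\ v = \sum_(i < m) a i *: s i >].

Lemma gen_submod_closed (S : V -> Prop) : submod_closed (gen_submod S).
Proof.
split.
  apply/asboolP; exists 0%N, (fun=> 0), (fun=> 0).
  by split; [case | rewrite big_ord0].
move=> c u v /asboolP[m [a [s [Ss ->]]]] /asboolP[p [b [t [St ->]]]].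
apply/asboolP; exists (m + p)%N.
exists (fun i => match split i with inl j => c * a j | inr j => b j end).
exists (fun i => match split i with inl j => s j | inr j => t j end).
split=> [i|]; first by case: (split i).
rewrite big_split_ord /= scaler_sumr; congr (_ + _); apply: eq_bigr => i _.
  by rewrite (unsplitK (inl i : 'I_m + 'I_p)) scalerA.
by rewrite (unsplitK (inr i : 'I_m + 'I_p)).
Qed.

HB.instance Definition _ S :=
  GRing.isSubmodClosed.Build R V (gen_submod S) (gen_submod_closed S).

End GeneratedSubmodule.

Section SubmoduleType.
Variables (R : nzRingType) (V : lmodType R).

Inductive submod_type (S : submodClosed V) : Type :=
  Submod (x : V) of x \in S.

Definition submod_val (S : submodClosed V) (u : submod_type S) : V :=
  let: Submod x _ := u in x.

HB.instance Definition _ (S : submodClosed V) :=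
  [isSub for @submod_val S].
HB.instance Definition _ (S : submodClosed V) :=
  [Choice of submod_type S by <:].
HB.instance Definition _ (S : submodClosed V) :=
  [SubChoice_isSubLmodule of submod_type S by <:].

(* The part of the submodule [T] lying in [S], as a submodule of [S]. *)
Definition trace_submod (S T : submodClosed V) : {pred submod_type S} :=
  fun u => val u \in T.

Lemma trace_submod_closed (S T : submodClosed V) :
  submod_closed (trace_submod (S := S) T).
Proof.
split=> [|c u v uT vT]; first exact: (rpred0 T).
have -> : (c *: u + v \in trace_submod T) = (c *: val u + val v \in T) by [].
by apply: rpredD => //; apply: rpredZ.
Qed.

HB.instance Definition _ (S T : submodClosed V) :=
  GRing.isSubmodClosed.Build R (submod_type S) (trace_submod (S := S) T)
    (trace_submod_closed S T).

End SubmoduleType.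

(* [ring_quotient] only gives the quotient of a Z-module; the action of [R]
   is added here. *)
Section QuotientModule.
Variables (R : nzRingType) (V : lmodType R) (S : submodClosed V).

(* [submodClosed] does not record closure under opposite, because it is also
   meant for semimodules; [submod_zmod] is [S] as a [zmodClosed]. *)
Definition submod_pred : {pred V} := fun v => v \in S.

Lemma submod_pred_zmod_closed : zmod_closed submod_pred.
Proof.
split=> [|u v uS vS]; first exact: (rpred0 S).
have -> : (u - v \in submod_pred) = (u - v \in S) by [].
by rewrite -scaleN1r; apply: rpredD => //; apply: rpredZ.
Qed.

HB.instance Definition _ :=
  GRing.isZmodClosed.Build V submod_pred submod_pred_zmod_closed.

Definition submod_zmod : zmodClosed V := submod_pred.

Definition quot_mod : Type := Quotient.quot submod_zmod.

HB.instance Definition _ := GRing.Zmodule.on quot_mod.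

Definition quot_proj (v : V) : quot_mod :=
  \pi_(Quotient.quot submod_zmod) v.

Lemma quot_projP (u v : V) : reflect (quot_proj u = quot_proj v) (u - v \in S).
Proof. by rewrite -[u - v \in S]/(u - v \in submod_zmod) Quotient.idealrBE; apply: eqP. Qed.

Lemma quot_proj_is_zmod_morphism : zmod_morphism quot_proj.
Proof. exact: raddfB. Qed.

Lemma quot_proj_surj (x : quot_mod) : exists v, x = quot_proj v.
Proof.
by exists (repr (x : Quotient.quot submod_zmod)); rewrite /quot_proj reprK.
Qed.

Definition quot_scale (c : R) (x : quot_mod) : quot_mod :=
  quot_proj (c *: repr (x : Quotient.quot submod_zmod)).

Lemma quot_scale_proj c v : quot_scale c (quot_proj v) = quot_proj (c *: v).
Proof.
apply/quot_projP; rewrite -scalerBr; apply: rpredZ.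
by apply/quot_projP; rewrite /quot_proj reprK.
Qed.

Let projD u v : quot_proj u + quot_proj v = quot_proj (u + v).
Proof. exact/esym/raddfD. Qed.

Let quot_scaleA a b x : quot_scale a (quot_scale b x) = quot_scale (a * b) x.
Proof. by have [v ->] := quot_proj_surj x; rewrite !quot_scale_proj scalerA. Qed.

Let quot_scale1 : left_id 1 quot_scale.
Proof.
by move=> x; have [v ->] := quot_proj_surj x; rewrite quot_scale_proj scale1r.
Qed.

Let quot_scaleDr : right_distributive quot_scale +%R.
Proof.
move=> a x y; have [u ->] := quot_proj_surj x; have [v ->] := quot_proj_surj y.
by rewrite projD !quot_scale_proj projD scalerDr.
Qed.

Let quot_scaleDl x : {morph quot_scale^~ x : a b / a + b}.
Proof.
move=> a b; have [v ->] := quot_proj_surj x.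
by rewrite !quot_scale_proj projD scalerDl.
Qed.

HB.instance Definition _ := GRing.Zmodule_isLmodule.Build R quot_mod
  quot_scaleA quot_scale1 quot_scaleDr quot_scaleDl.

Lemma quot_proj_is_scalable : scalable quot_proj.
Proof. by move=> c v; rewrite -[LHS]quot_scale_proj. Qed.

HB.instance Definition _ := GRing.isZmodMorphism.Build V quot_mod quot_proj
  quot_proj_is_zmod_morphism.
HB.instance Definition _ := GRing.isScalable.Build R V quot_mod *:%R quot_proj
  quot_proj_is_scalable.

End QuotientModule.

Section DirectSum.
Variables (R : nzRingType) (I : finType) (T : I -> lmodType R).

Definition direct_sum : Type := {dffun forall i, T i}.

HB.instance Definition _ := Choice.on direct_sum.

Implicit Types u v : direct_sum.

Definition dsum_zero : direct_sum := [ffun i => 0 : T i].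
Definition dsum_opp u : direct_sum := [ffun i => - (u i : T i)].
Definition dsum_add u v : direct_sum := [ffun i => (u i : T i) + v i].
Definition dsum_scale (c : R) u : direct_sum := [ffun i => c *: (u i : T i)].

Let dsum_addA : associative dsum_add.
Proof. by move=> u v w; apply/ffunP => i; rewrite !ffunE addrA. Qed.
Let dsum_addC : commutative dsum_add.
Proof. by move=> u v; apply/ffunP => i; rewrite !ffunE addrC. Qed.
Let dsum_add0 : left_id dsum_zero dsum_add.
Proof. by move=> u; apply/ffunP => i; rewrite !ffunE add0r. Qed.
Let dsum_addN : left_inverse dsum_zero dsum_opp dsum_add.
Proof. by move=> u; apply/ffunP => i; rewrite !ffunE addNr. Qed.

HB.instance Definition _ := GRing.isZmodule.Build direct_sum
  dsum_addA dsum_addC dsum_add0 dsum_addN.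

Let dsum_scaleA a b u : dsum_scale a (dsum_scale b u) = dsum_scale (a * b) u.
Proof. by apply/ffunP => i; rewrite !ffunE scalerA. Qed.
Let dsum_scale1 : left_id 1 dsum_scale.
Proof. by move=> u; apply/ffunP => i; rewrite !ffunE scale1r. Qed.
Let dsum_scaleDr : right_distributive dsum_scale +%R.
Proof. by move=> a u v; apply/ffunP => i; rewrite !ffunE scalerDr. Qed.
Let dsum_scaleDl u : {morph dsum_scale^~ u : a b / a + b}.
Proof. by move=> a b; apply/ffunP => i; rewrite !ffunE scalerDl. Qed.

HB.instance Definition _ := GRing.Zmodule_isLmodule.Build R direct_sum
  dsum_scaleA dsum_scale1 dsum_scaleDr dsum_scaleDl.

End DirectSum.

Section FittingModule.
Variable R : comNzRingType.

(* I_j(phi). The empty minor is 1, so I_0(phi) = R; there is no strictly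
   increasing map from 'I_j if j > min(m, n), and then I_j(phi) = 0. *)
Definition minors_ideal (n m : nat) (phi : 'M[R]_(n, m)) (j : nat) :
    submodClosed R^o :=
  gen_submod (fun p : R^o => exists (f : 'I_j -> 'I_n) (g : 'I_j -> 'I_m),
    [/\ {homo f : a b / (a < b)%N}, {homo g : a b / (a < b)%N}
      & p = \det (mxsub f g phi)]).

(* Fitt(M) for M the cokernel of phi : R^m -> R^n (acting on columns). As
   Fitt_i(M) = I_(n - i)(phi), the j-th summand
   Fitt_(n - j)(M) / Fitt_(n - j - 1)(M) is I_j(phi) / I_(j + 1)(phi). *)
Definition fitting_summand (n m : nat) (phi : 'M[R]_(n, m)) (j : nat) :
    lmodType R :=
  quot_mod (trace_submod (S := minors_ideal phi j) (minors_ideal phi j.+1)).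

Definition fitting_module (n m : nat) (phi : 'M[R]_(n, m)) : lmodType R :=
  direct_sum (fun j : 'I_n.+1 => fitting_summand phi j).

Definition ideal_mul (J : {pred R^o}) (M : lmodType R) : {pred M} :=
  gen_submod (fun w : M => exists a u, a \in J /\ w = a *: u).

End FittingModule.

Arguments ideal_mul {R} J M _.

(* [gr t] is the set of homogeneous elements of degree [t] of [M] (including
   0), and [N] is a graded submodule, so that [N_t] is [N] intersected with
   [gr t]. *)
Definition is_alpha (M : zmodType) (gr : nat -> M -> Prop) (N : {pred M})
    (a : nat) : Prop :=
  let component_nonzero t := exists u, [/\ u \in N, gr t u & u != 0] in
  component_nonzero a /\ (forall t, component_nonzero t -> (a <= t)%N).

Section PolynomialGrading.
Variables (K : fieldType) (k : nat).
Notation R := {mpoly K[k]}.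

Definition irrelevant_ideal : {pred R^o} :=
  gen_submod (fun p : R^o => exists i : 'I_k, p = 'X_i).

Definition fitting_summand_degree (n m : nat) (phi : 'M[R]_(n, m)) (j t : nat)
    (x : fitting_summand phi j) : Prop :=
  exists p : submod_type (minors_ideal phi j),
    (val p : R) \is t.-homog /\ x = quot_proj _ p.

Definition fitting_degree (n m : nat) (phi : 'M[R]_(n, m)) (t : nat)
    (u : fitting_module phi) : Prop :=
  forall j : 'I_n.+1, fitting_summand_degree t (u j).

End PolynomialGrading.

Arguments irrelevant_ideal K k : clear implicits.
Arguments fitting_degree {K k n m} phi t u.

Section Codes.
Variable K : fieldType.

Definition generating_matrix (k n : nat) (G : 'M[K]_(k, n))
    (C : {vspace 'rV[K]_n}) : Prop :=
  \rank G = k /\ (forall c : 'rV[K]_n, c \in C <-> exists x, c = x *m G).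

Definition weight (n : nat) (c : 'rV[K]_n) : nat := #|[set j | c 0 j != 0]|.

Definition is_min_distance (n : nat) (C : {vspace 'rV[K]_n}) (d : nat) : Prop :=
  (exists c, [/\ c \in C, c != 0 & weight c = d]) /\
  (forall c, c \in C -> c != 0 -> (d <= weight c)%N).

Definition is_linear_code (n k d : nat) (C : {vspace 'rV[K]_n}) : Prop :=
  [/\ (0 < k)%N, exists G : 'M[K]_(k, n), generating_matrix G C
    & is_min_distance C d].

Definition dual_form (k n : nat) (G : 'M[K]_(k, n)) (j : 'I_n) : {mpoly K[k]} :=
  \sum_(i < k) G i j *: 'X_i.

Definition code_presentation (k n : nat) (G : 'M[K]_(k, n)) :
    'M[{mpoly K[k]}]_n :=
  diag_mx (\row_j dual_form G j).

Definition code_fitting (k n : nat) (G : 'M[K]_(k, n)) :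
    lmodType {mpoly K[k]} :=
  fitting_module (code_presentation G).

End Codes.

(* Main.v *)
Require Import Defs.
From HB Require Import structures.
From mathcomp Require Import all_boot all_order all_algebra.
From mathcomp Require Import boolp mpoly.
Set Implicit Arguments.
Unset Strict Implicit.
Unset Printing Implicit Defensive.
Import GRing.Theory.
Local Open Scope ring_scope.

(** Let [ell_1, ..., ell_n] be the dual forms, [I_j] the ideal generated by the
    products of [j] of them with distinct indices, [m] the irrelevant ideal and
    [d] the minimum distance. The Fitting module is the direct sum of the
    [I_j / I_(j+1)], so [m Fitt] is the direct sum of the submodules generated
    by [m I_j], and these can be treated one [j] at a time.

    - If [j < d], then [m I_j] lies in [I_(j+1)], so the summand is zero
      ([irrelevant_mul_minors_ideal]). Indeed, after [j < d] forms have been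
      removed the others still span all linear forms, as a nonzero common zero
      of these would give a nonzero codeword of weight less than [d]. Each
      variable times a product of [j] forms is therefore a combination of
      products of [j + 1] forms.
    - If [j >= d], every element of the summand is represented in [m I_j],
      which starts in degree [j + 1 >= d + 1]; hence nothing is left in degree
      at most [d] ([summand_homog_eq0]).
    - For [j = d] the component of degree [d + 1] is nonzero
      ([fitting_component_nonzero]). Let [c] be the message vector of a codeword
      of minimum weight: exactly [d] forms do not vanish at [c], so every
      product of [d + 1] distinct forms vanishes at [c], hence so does all of
      [I_(d+1)]. But the product of those [d] forms times a variable which is
      nonzero at [c] lies in [m I_d] and does not vanish at [c].

    That the ideals of minors of a diagonal matrix are the ideals [I_j] is
    [minors_ideal_diag]. *)

(** * Generated submodules *)

Lemma gen_submod_mem (R : nzRingType) (V : lmodType R) (S : V -> Prop) v :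
  S v -> v \in gen_submod S.
Proof.
move=> Sv; apply/asboolP; exists 1%N, (fun=> 1), (fun=> v).
by split=> //; rewrite big_ord1 scale1r.
Qed.

Lemma gen_submod_ind (R : nzRingType) (V : lmodType R) (S P : V -> Prop) :
    P 0 -> (forall a u v, P u -> P v -> P (a *: u + v)) ->
    (forall v, S v -> P v) ->
  forall v, v \in gen_submod S -> P v.
Proof.
move=> P0 Pcomb PS v /asboolP[m [a [s [Ss ->]]]].
by elim/big_rec: _ => // i u _ Pu; apply: Pcomb => //; apply: PS.
Qed.

Lemma gen_submod_sub (R : nzRingType) (V : lmodType R) (S : V -> Prop)
    (T : submodClosed V) :
  (forall v, S v -> v \in T) -> {subset gen_submod S <= T}.
Proof.
move=> ST v v_in; elim/gen_submod_ind: v / v_in => // [|a u v uT vT].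
  exact: (rpred0 T).
by apply: rpredD => //; apply: rpredZ.
Qed.

Lemma idealMl (R : nzRingType) (T : submodClosed R^o) (a p : R) :
  p \in T -> a * p \in T.
Proof. exact: (@rpredZ R R^o T a p). Qed.

(** This allows the product of the irrelevant ideal with the Fitting module to
    be studied in each summand separately. *)
Lemma ideal_mul_coord (R : comNzRingType) (I : finType) (T : I -> lmodType R)
    (J : {pred R^o}) (u : direct_sum T) (i : I) :
  u \in ideal_mul J (direct_sum T) -> u i \in ideal_mul J (T i).
Proof.
rewrite /ideal_mul => Ju.
elim/gen_submod_ind: u / Ju => [|a u v|_ [a [u [Ja ->]]]].
- by rewrite ffunE; exact: (rpred0 (gen_submod _)).
- move=> Ju Jv.
  have -> : (a *: u + v) i = a *: (u i : T i) + v i by rewrite !ffunE.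
  by apply: rpredD => //; apply: rpredZ.
- by apply: gen_submod_mem; exists a, (u i); rewrite ffunE.
Qed.

(** * Minors of diagonal matrices *)

Lemma prod_enum_val (R : comNzRingType) n (v : 'I_n -> R) (A : {set 'I_n}) :
  \prod_(i < #|A|) v (enum_val i) = \prod_(i in A) v i.
Proof. exact/esym/(@big_enum_val _ _ _ _ (mem A)). Qed.

Lemma enum_val_ltn n (A : {set 'I_n}) :
  {homo (@enum_val _ (mem A)) : a b / (a < b)%N}.
Proof.
have enum_sorted : sorted (relpre val ltn) (enum A).
  rewrite -[enum _](eq_filter (mem_enum _)) sorted_filter //.
    by move=> i j l; apply: ltn_trans.
  by rewrite -sorted_map unlock val_ord_enum iota_ltn_sorted.
move=> a b lt_ab; have i0 := enum_val a; rewrite !(enum_val_nth i0).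
by apply: (sorted_ltn_nth _ _ enum_sorted); rewrite ?inE -?cardE //;
  move=> i j l; apply: ltn_trans.
Qed.

(** Row [a] of the submatrix is a 0/1 row scaled by [v 0 (f a)]. This makes
    every minor a multiple of a product of distinct diagonal entries, whether
    or not [f] and [g] select the same indices. *)
Lemma det_mxsub_diag (R : comNzRingType) n j (v : 'rV[R]_n)
    (f g : 'I_j -> 'I_n) :
  \det (mxsub f g (diag_mx v)) =
  \det (\matrix_(a, b) (f a == g b)%:R) * \prod_a v 0 (f a).
Proof.
have -> : mxsub f g (diag_mx v) =
    diag_mx (\row_a v 0 (f a)) *m \matrix_(a, b) (f a == g b)%:R.
  by rewrite mul_diag_mx; apply/matrixP => a b; rewrite !mxE mulr_natr.
rewrite det_mulmx det_diag mulrC; congr (_ * _).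
by apply: eq_bigr => a _; rewrite mxE.
Qed.

Lemma minors_ideal_diag (R : comNzRingType) n j (v : 'rV[R]_n) :
  minors_ideal (diag_mx v) j =i gen_submod (fun p : R^o =>
    exists2 A : {set 'I_n}, #|A| = j & p = \prod_(i in A) v 0 i).
Proof.
move=> p; apply/idP/idP; move: p; apply: gen_submod_sub.
- move=> _ [f [g [f_lt g_lt ->]]]; rewrite det_mxsub_diag.
  have f_inj : injective f.
    move=> a b eq_fab; apply/val_inj; case: (ltngtP a b) => // /f_lt;
      by rewrite eq_fab ltnn.
  apply: idealMl; apply: gen_submod_mem.
  exists (f @: setT); first by rewrite card_imset // cardsT card_ord.
  rewrite big_imset /=; last by move=> a b _ _; apply: f_inj.
  by apply: eq_bigl => a; rewrite inE.
- move=> _ [A <- ->]; apply: gen_submod_mem.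
  exists (@enum_val _ (mem A)), (@enum_val _ (mem A)).
  split; [exact: enum_val_ltn | exact: enum_val_ltn |].
  have := det_mxsub_diag v (@enum_val _ (mem A)) (@enum_val _ (mem A)).
  rewrite prod_enum_val => ->.
  have -> : \matrix_(a, b) (enum_val a == enum_val b)%:R = 1%:M :> 'M[R]_#|A|.
    by apply/matrixP => a b; rewrite !mxE (inj_eq enum_val_inj).
  by rewrite det1 mul1r.
Qed.

(** * Order of vanishing at the origin *)

Section Order.
Variables (K : fieldType) (k : nat).
Implicit Types p q : {mpoly K[k]}.

(** Membership in the [m]-th power of the irrelevant ideal. *)
Definition order_ge m p :=
  forall mon : 'X_{1..k}, (mdeg mon < m)%N -> p@_mon = 0.

Lemma order_geD m p q : order_ge m p -> order_ge m q -> order_ge m (p + q).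
Proof. by move=> mp mq mon lt_mon; rewrite mcoeffD mp ?mq ?addr0. Qed.

Lemma order_geM a b p q :
  order_ge a p -> order_ge b q -> order_ge (a + b) (p * q).
Proof.
move=> ap bq mon lt_mon.
rewrite mcoeffM big1 // => -[m1 m2] /= /eqP/(congr1 mdeg).
rewrite mdegD => def_deg.
have [/ap-> | ge_a] := ltnP (mdeg m1) a; first by rewrite mul0r.
rewrite bq ?mulr0 // -(ltn_add2l a); apply: leq_ltn_trans lt_mon.
by rewrite [leqRHS]def_deg leq_add2r.
Qed.

Lemma dhomog_order_ge m p : p \is m.-homog -> order_ge m p.
Proof.
by move=> hp mon lt_mon; apply: (dhomog_nemf_coeff hp); rewrite neq_ltn lt_mon.
Qed.

Lemma dhomog_order_ge_eq0 m t p :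
  p \is t.-homog -> order_ge m p -> (t < m)%N -> p = 0.
Proof.
move=> hp mp lt_tm; apply/mpolyP => mon; rewrite mcoeff0.
have [eq_t | ne_t] := eqVneq (mdeg mon) t; first by apply: mp; rewrite eq_t.
exact: (dhomog_nemf_coeff hp).
Qed.

Lemma irrelevant_order_ge p : p \in irrelevant_ideal K k -> order_ge 1 p.
Proof.
move=> p_in; elim/gen_submod_ind: p / p_in => [mon|a p q hp hq|_ [i ->]].
- by rewrite mcoeff0.
- by apply: order_geD hq; apply: (@order_geM 0 1).
- by apply: dhomog_order_ge; rewrite dhomogX /= mdeg1.
Qed.

End Order.

(** * The ideals of products of dual forms *)

Section LinearCode.
Variables (K : fieldType) (k n : nat) (G : 'M[K]_(k, n)).
Local Notation ell := (dual_form G).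
Local Notation I j := (minors_ideal (code_presentation G) j).

Lemma dual_form_homog j : ell j \is 1.-homog.
Proof.
by apply: rpred_sum => i _; apply: rpredZ; rewrite dhomogX /= mdeg1.
Qed.

Lemma dual_form_eval (x : 'rV[K]_k) j :
  (ell j).@[fun i => x 0 i] = (x *m G) 0 j.
Proof.
rewrite raddf_sum mxE; apply: eq_bigr => i _ /=.
by rewrite mevalZ mevalXU mulrC.
Qed.

Lemma prod_dual_form_homog (A : {set 'I_n}) :
  \prod_(i in A) ell i \is #|A|.-homog.
Proof.
rewrite -sum1_card; elim/big_rec2: _ => [|i p m _ hm]; first exact: dhomog1.
by apply: dhomogM => //; apply: dual_form_homog.
Qed.

Lemma code_minors_ideal j : I j =i gen_submod (fun p : {mpoly K[k]}^o =>
  exists2 A : {set 'I_n}, #|A| = j & p = \prod_(i in A) ell i).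
Proof.
move=> p; rewrite minors_ideal_diag; congr (p \in gen_submod _).
by apply/funext => q; apply/propext; split=> -[A cA ->]; exists A => //;
  apply: eq_bigr => i _; rewrite mxE.
Qed.

Lemma code_minors_ideal_ind j (P : {mpoly K[k]} -> Prop) :
    P 0 -> (forall a p q, P p -> P q -> P (a * p + q)) ->
    (forall A : {set 'I_n}, #|A| = j -> P (\prod_(i in A) ell i)) ->
  forall p, p \in I j -> P p.
Proof.
move=> P0 Pcomb Pprod p; rewrite code_minors_ideal.
by move=> p_in; elim/gen_submod_ind: p / p_in => // _ [A cA ->]; apply: Pprod.
Qed.

Lemma prod_code_minors_ideal (A : {set 'I_n}) : \prod_(i in A) ell i \in I #|A|.
Proof. by rewrite code_minors_ideal; apply: gen_submod_mem; exists A. Qed.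

Lemma code_minors_ideal_order_ge j (p : {mpoly K[k]}) :
  p \in I j -> order_ge j p.
Proof.
move=> p_in; elim/code_minors_ideal_ind: p / p_in => [mon|a p q hp hq|A <-].
- by rewrite mcoeff0.
- by apply: order_geD hq; apply: (@order_geM _ _ 0 j).
- exact/dhomog_order_ge/prod_dual_form_homog.
Qed.

(** A set of [j] indices is too large to fit in the support of the codeword, so
    each generator has a factor vanishing at [x]. *)
Lemma code_minors_ideal_vanish (x : 'rV[K]_k) j (p : {mpoly K[k]}) :
  (weight (x *m G) < j)%N -> p \in I j -> p.@[fun i => x 0 i] = 0.
Proof.
move=> lt_wj p_in.
elim/code_minors_ideal_ind: p / p_in => [|a p q hp hq|A cA].
- exact: meval0.
- by rewrite mevalD mevalM hp hq mulr0 addr0.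
- have /subsetPn[i iA /negP ix] : ~~ (A \subset [set i | (x *m G) 0 i != 0]).
    by apply: contraL lt_wj => /subset_leq_card; rewrite cA -leqNgt.
  rewrite rmorph_prod (bigD1 i) //= dual_form_eval.
  have -> : (x *m G) 0 i = 0 by apply/eqP/negPn/negP; move: ix; rewrite inE.
  by rewrite mul0r.
Qed.

(** * Powers of the irrelevant ideal and the minimum distance *)

(** If the forms indexed outside [A] did not span all linear forms, they would
    have a common zero [x != 0]; the codeword of [x] would then be supported
    in [A] and so have weight less than [d]. *)
Lemma var_dual_form_comb d (A : {set 'I_n}) :
    (forall x : 'rV[K]_k, x != 0 -> (d <= weight (x *m G))%N) ->
    (#|A| < d)%N ->
  forall i, exists b : 'I_n -> K, 'X_i = \sum_(s | s \notin A) b s *: ell s.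
Proof.
move=> G_dist lt_Ad i.
(* [H] is [G] with the columns in [A] erased: its row kernel is the space of
   common zeros above, and a right inverse of [H] lists the coefficients [b]. *)
pose H : 'M[K]_(k, n) := \matrix_(r, s) (if s \in A then 0 else G r s).
have : row_free H.
  apply: inj_row_free => x xH0; apply: contraTeq lt_Ad => /G_dist.
  rewrite -leqNgt => /leq_trans-> //; apply/subset_leq_card/subsetP => s.
  rewrite inE; apply: contraNT => sA; have /rowP/(_ s) := xH0.
  rewrite !mxE => xH0s; apply/eqP; rewrite -[RHS]xH0s; apply: eq_bigr => r _.
  by rewrite mxE (negPf sA).
case/row_freeP=> B HB1; exists (fun s => B s i).
have -> : 'X_i = \sum_r (H *m B) r i *: 'X_r :> {mpoly K[k]}.
  rewrite HB1 (bigD1 i) //= mxE eqxx scale1r big1 ?addr0 // => r ri.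
  by rewrite mxE (negPf ri) scale0r.
under eq_bigr => r _ do rewrite mxE scaler_suml.
rewrite exchange_big [RHS]big_mkcond /=; apply: eq_bigr => s _.
have [sA | sA] /= := boolP (s \in A).
  by apply: big1 => r _; rewrite mxE sA mul0r scale0r.
rewrite scaler_sumr; apply: eq_bigr => r _.
by rewrite mxE (negPf sA) scalerA mulrC.
Qed.

(** For a product over [A] with [#|A| = j < d], expand the variable in the forms
    outside [A]: every term gains a factor with a new index. *)
Lemma irrelevant_mul_minors_ideal d j (a p : {mpoly K[k]}) :
    (forall x : 'rV[K]_k, x != 0 -> (d <= weight (x *m G))%N) -> (j < d)%N ->
  a \in irrelevant_ideal K k -> p \in I j -> a * p \in I j.+1.
Proof.
move=> G_dist lt_jd a_in p_in.
elim/gen_submod_ind: a / a_in => [|c a b ha hb|_ [i ->]].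
- by rewrite mul0r; exact: (rpred0 (gen_submod _)).
- have -> : (c *: a + b) * p = c * (a * p) + b * p.
    by rewrite mulrDl -[c *: a]/(c * a) mulrA.
  by apply: rpredD hb; apply: idealMl.
elim/code_minors_ideal_ind: p / p_in => [|c p q hp hq|A cA].
- by rewrite mulr0; exact: (rpred0 (gen_submod _)).
- rewrite mulrDr mulrCA.
  by apply: rpredD hq; apply: idealMl.
have [|b ->] := var_dual_form_comb G_dist _ i (A := A); first by rewrite cA.
rewrite mulr_suml; apply: rpred_sum => s sA.
rewrite -scalerAl -mul_mpolyC; apply: idealMl.
rewrite -big_setU1 // -cA.
have <- : #|s |: A| = #|A|.+1 by rewrite cardsU1 sA.
exact: prod_code_minors_ideal.
Qed.

(** * Graded components of the summands *)

Lemma irrelevant_mul_summand_order_ge j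
    (x : fitting_summand (code_presentation G) j) :
  x \in ideal_mul (irrelevant_ideal K k) (fitting_summand _ j) ->
  exists2 q : submod_type (I j),
    x = quot_proj _ q & order_ge j.+1 (val q : {mpoly K[k]}).
Proof.
rewrite /ideal_mul => x_in.
elim/gen_submod_ind: x / x_in => [|a x y|_ [a [x [a_in ->]]]].
- by exists 0; [rewrite raddf0 | move=> mon _; rewrite mcoeff0].
- move=> [p -> p_ge] [q -> q_ge]; exists (a *: p + q).
    by rewrite raddfD /= linearZ.
  by apply: order_geD q_ge; apply: (@order_geM _ _ 0 j.+1).
- have [p ->] := quot_proj_surj x; exists (a *: p); first by rewrite linearZ.
  apply: (@order_geM _ _ 1 j); first exact: irrelevant_order_ge.
  exact/code_minors_ideal_order_ge/valP.
Qed.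

(** A homogeneous representative [p] need not itself lie in the product of the
    irrelevant ideal with [I j], but it differs from an element of that product
    by an element of [I j.+1], and both have order at least [j.+1]. *)
Lemma summand_homog_eq0 j t (x : fitting_summand (code_presentation G) j) :
    (t <= j)%N -> fitting_summand_degree t x ->
  x \in ideal_mul (irrelevant_ideal K k) (fitting_summand _ j) -> x = 0.
Proof.
move=> le_tj [p [p_homog ->]] /irrelevant_mul_summand_order_ge[q eq_pq q_ge].
suff -> : p = 0 by rewrite raddf0.
apply: val_inj; apply: dhomog_order_ge_eq0 p_homog _ (le_tj : (t < j.+1)%N).
have /quot_projP/code_minors_ideal_order_ge pq_ge := eq_pq.
by rewrite -[val p](subrK (val q)); apply: order_geD pq_ge q_ge.
Qed.

Lemma irrelevant_mul_summand_eq0 d j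
    (x : fitting_summand (code_presentation G) j) :
    (forall c : 'rV[K]_k, c != 0 -> (d <= weight (c *m G))%N) -> (j < d)%N ->
  x \in ideal_mul (irrelevant_ideal K k) (fitting_summand _ j) -> x = 0.
Proof.
move=> G_dist lt_jd; rewrite /ideal_mul => x_in.
elim/gen_submod_ind: x / x_in => [|a x y -> ->|_ [a [x [a_in ->]]]] //.
  by rewrite scaler0 addr0.
have [p ->] := quot_proj_surj x; rewrite -linearZ -[RHS](raddf0 (quot_proj _)).
apply/quot_projP; rewrite subr0.
exact: (irrelevant_mul_minors_ideal G_dist lt_jd a_in (valP p)).
Qed.

(** Let [P] be the product of the forms not vanishing at [c]. A variable times
    [P] may be nonzero at [c], whereas the ideal [I] of index one more than the
    weight vanishes at [c]; so the class of that multiple of [P] is nonzero in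
    the summand indexed by the weight. *)
Lemma fitting_component_nonzero (c : 'rV[K]_k) : c != 0 ->
  exists u : code_fitting G,
    [/\ u \in ideal_mul (irrelevant_ideal K k) (code_fitting G),
        fitting_degree (code_presentation G) (weight (c *m G)).+1 u & u != 0].
Proof.
move=> /rV0Pn[i ci0].
pose A := [set s | (c *m G) 0 s != 0]; pose P := \prod_(s in A) ell s.
(* Only the summand [#|A|] is used to see that the element is nonzero; using the
   class of [P] wherever [P] lies in [I j], and 0 in the other summands, gives a
   uniform formula and leaves every component homogeneous. *)
pose w j : submod_type (I j) := insubd 0 (P : {mpoly K[k]}^o).
pose u : code_fitting G := [ffun j : 'I_n.+1 => quot_proj _ (w j)].
exists ('X_i *: u); split.
- apply: gen_submod_mem; exists 'X_i, u; split=> //.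
  by apply: gen_submod_mem; exists i.
- move=> j; exists ('X_i *: w j); split; last by rewrite !ffunE linearZ.
  change ('X_i * (val (w j) : {mpoly K[k]}) \is (weight (c *m G)).+1.-homog).
  apply: (@dhomogM _ _ _ 1).
    by rewrite dhomogX /= mdeg1.
  rewrite val_insubd; case: ifP => _; last exact: rpred0.
  exact: prod_dual_form_homog.
- have lt_An : (#|A| < n.+1)%N by rewrite ltnS -[n in leqRHS]card_ord max_card.
  apply/eqP => /(congr1 (fun v : code_fitting G => v (Ordinal lt_An))).
  rewrite !ffunE -linearZ -(raddf0 (quot_proj _)) => /quot_projP.
  rewrite subr0 => /(@code_minors_ideal_vanish c _ _ (ltnSn _)).
  rewrite /= insubdK; last exact: prod_code_minors_ideal.
  rewrite -[_ *: _]/('X_i * P) mevalM mevalXU rmorph_prod => /eqP.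
  rewrite mulf_eq0 (negPf ci0) => /prodf_eq0[s].
  by rewrite inE -dual_form_eval => /negPf ->.
Qed.

End LinearCode.

Theorem theorem2p1 (K : fieldType) (n k d : nat) (C : {vspace 'rV[K]_n})
    (G : 'M[K]_(k, n)) :
  is_linear_code k d C ->
  generating_matrix G C ->
  exists2 a : nat,
    is_alpha (fitting_degree (code_presentation G))
      (ideal_mul (irrelevant_ideal K k) (code_fitting G)) a
    & d%:Z = a%:Z - 1.
Proof.
move=> [_ _ [[c [cC c0 wc]] min_d]] [rkG defC].
have G_free : row_free G by apply/eqP.
have G_dist (x : 'rV[K]_k) : x != 0 -> (d <= weight (x *m G))%N.
  move=> x0; apply: min_d; first by apply/defC; exists x.
  apply: contraNneq x0 => xG0.
  by apply/eqP/(row_free_inj G_free); rewrite mul0mx.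
exists d.+1; last by rewrite -addn1 PoszD addrK.
split.
  have /defC[x def_c] := cC; rewrite -wc def_c.
  apply: fitting_component_nonzero.
  by apply: contraNneq c0 => x0; rewrite def_c x0 mul0mx.
move=> t [u [u_in u_deg u0]]; rewrite ltnNge; apply: contra u0 => le_td.
apply/eqP/ffunP => j; rewrite [RHS]ffunE.
have uj_in := ideal_mul_coord j u_in.
have [lt_jd | le_dj] := ltnP j d.
  exact: irrelevant_mul_summand_eq0 G_dist lt_jd uj_in.
exact: summand_homog_eq0 (leq_trans le_td le_dj) (u_deg j) uj_in.
Qed.
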